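(* Let $M=(E,\mathcal I)$ be a matroid with base family $\mathcal B$, and let $\widetilde{\mathcal B}$ be a Fulkerson dual family of $\mathcal B$. Let $\rho\in\mathbb R^E_{\ge 0}$, $\eta\in\mathbb R^E_{\ge0}$, and let $\mu$ be a probability mass function on $\mathcal B$. Then $\rho$, $\eta$ and $\mu$ are optimal, respectively, for $\mathrm{Mod}_2(\mathcal B)$, $\mathrm{Mod}_2(\widetilde{\mathcal B})$ and $\mathrm{MEO}(\mathcal B)$ if and only if the following three conditions hold: (i) $\rho\in\mathrm{Adm}(\mathcal B)$ and $\eta(e)=\sum_{B\in\mathcal B:\,e\in B}\mu(B)$ for all $e\in E$; (ii) there is a constant $c>0$ such that $\rho(e)=c\,\eta(e)$ for all $e\in E$; (iii) $\mu(B)\,(1-\ell_\rho(B))=0$ for all $B\in\mathcal B$, where $\ell_\rho(B)=\sum_{e\in B}\rho(e)$. Moreover, in this case the constant $c$ in (ii) equals $\mathrm{Mod}_2(\mathcal B)$ and $1/c=\mathrm{MEO}(\mathcal B)=\mathrm{Mod}_2(\widetilde{\mathcal B})$.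
   Context: A matroid $M=(E,\mathcal I)$ on a finite set $E$ has rank function $r$ and base family $\mathcal B$ (maximal independent sets, all of size $r(E)$). Standing assumption: all matroids are loopless (every singleton is independent) and have $r(E)>0$. Each base is identified with its indicator vector in $\mathbb R^E$. For a family $\Gamma$ of vectors in $\mathbb R^E_{\ge0}$, $\mathrm{Adm}(\Gamma)=\{\rho\in\mathbb R^E_{\ge0}:\sum_{e}\gamma(e)\rho(e)\ge 1\ \forall\gamma\in\Gamma\}$ and $\mathrm{Mod}_2(\Gamma)=\inf\{\sum_{e\in E}\rho(e)^2:\rho\in\mathrm{Adm}(\Gamma)\}$; a density is optimal if it attains this infimum. The blocker of $K\subseteq\mathbb R^E_{\ge0}$ is $\mathrm{BL}(K)=\{\eta\in\mathbb R^E_{\ge0}:\eta^T\rho\ge1\ \forall\rho\in K\}$. A set $\widetilde{\mathcal B}\subseteq\mathbb R^E_{\ge0}$ is a Fulkerson dual family of $\mathcal B$ if $\mathrm{Adm}(\widetilde{\mathcal B})=\mathrm{BL}(\mathrm{Adm}(\mathcal B))$. The minimum expected overlap is $\mathrm{MEO}(\mathcal B)=\min_{\mu}\sum_{B,B'\in\mathcal B}\mu(B)\mu(B')|B\cap B'|$, the minimum over probability mass functions $\mu$ on $\mathcal B$; $\mu$ is optimal if it attains the minimum. *)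

(* Defs.v *)
From mathcomp Require Import all_boot all_order all_algebra.
From mathcomp Require Import boolp classical_sets reals ereal.

Set Implicit Arguments.
Unset Strict Implicit.
Unset Printing Implicit Defensive.

Import Order.TTheory GRing.Theory Num.Theory.
Local Open Scope ring_scope.

(* {set E} (finite sets, scope set_scope) holds subsets of the ground set;
   set {ffun E -> R} (classical sets) holds families of vectors of R^E. *)

Record matroid (E : finType) := Matroid {
  indep : {set {set E}};
  indep0 : finset.set0 \in indep;
  indepS : forall A B : {set E}, A \subset B -> B \in indep -> A \in indep;
  indep_augment : forall A B : {set E}, A \in indep -> B \in indep ->
    (#|A| < #|B|)%N -> exists2 x, x \in B :\: A & x |: A \in indep
}.

Definition rank (E : finType) (M : matroid E) (A : {set E}) : nat :=
  (\max_(I in indep M | I \subset A) #|I|)%N.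

Definition bases (E : finType) (M : matroid E) : {set {set E}} :=
  [set B : {set E} | maxset (mem (indep M)) B]%SET.

Definition loopless (E : finType) (M : matroid E) : Prop :=
  forall e : E, [set e]%SET \in indep M.

Section Modulus.
Context {R : realType} {E : finType}.
Implicit Types (rho eta : {ffun E -> R}) (Gamma K : set {ffun E -> R}).

Definition nonneg rho : Prop := forall e, 0 <= rho e.

Definition dot rho eta : R := \sum_(e : E) rho e * eta e.

Definition Adm Gamma : set {ffun E -> R} :=
  [set rho | nonneg rho /\ forall gamma, Gamma gamma -> 1 <= dot gamma rho]%classic.

Definition energy2 rho : R := \sum_(e : E) rho e ^+ 2.

(* Valued in the extended reals, so that the modulus is +oo when no density
   is admissible. *)
Definition Mod2 Gamma : \bar R :=
  ereal_inf [set (energy2 rho)%:E | rho in Adm Gamma]%classic.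

Definition optimal_Mod2 Gamma rho : Prop :=
  Adm Gamma rho /\ (energy2 rho)%:E = Mod2 Gamma.

Definition BL K : set {ffun E -> R} :=
  [set eta | nonneg eta /\ forall rho, K rho -> 1 <= dot eta rho]%classic.

Definition Fulkerson_dual Gamma Gamma' : Prop :=
  (forall gamma, Gamma' gamma -> nonneg gamma) /\ Adm Gamma' = BL (Adm Gamma).

Definition indicator (B : {set E}) : {ffun E -> R} := [ffun e => (e \in B)%:R].

Definition vectors (F : {set {set E}}) : set {ffun E -> R} :=
  [set indicator B | B in [set` F]]%classic.

Definition length rho (B : {set E}) : R := \sum_(e in B) rho e.

(* A mass function on F is given by a function on all subsets of E; its values
   outside F are never used. *)
Implicit Types (F : {set {set E}}) (mu : {set E} -> R).

Definition is_pmf F mu : Prop :=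
  (forall B, B \in F -> 0 <= mu B) /\ \sum_(B in F) mu B = 1.

Definition overlap F mu : R :=
  \sum_(B in F) \sum_(B' in F) mu B * mu B' * #|B :&: B'|%:R.

(* Written as an infimum; it is finite when F is nonempty, and an optimal mass
   function is one at which it is attained. *)
Definition MEO F : \bar R :=
  ereal_inf [set (overlap F mu)%:E | mu in is_pmf F]%classic.

Definition optimal_MEO F mu : Prop :=
  is_pmf F mu /\ (overlap F mu)%:E = MEO F.

End Modulus.

(* Main.v *)
(** The edge usage vector [eta] of a mass function [mu] satisfies
[overlap mu = |eta|^2] and [<rho, eta> = E_mu(length rho B)], so it lies in the
blocker of [Adm(bases)].  If [mu] minimizes the overlap, moving mass towards a
single base cannot decrease [|eta|^2], which says [<1_B, eta> >= |eta|^2] for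
every base [B]: the density [eta / |eta|^2] is admissible.  Since every
admissible [rho] and every [eta'] in the blocker satisfy [<rho, eta'> >= 1], the
vectors [eta / |eta|^2] and [eta] are then the points of least norm of
[Adm(bases)] and of its blocker. *)

Require Import Defs.
From mathcomp Require Import all_boot all_order all_algebra.
From mathcomp Require Import boolp classical_sets reals ereal.
From mathcomp Require Import ring lra.

Set Implicit Arguments.
Unset Strict Implicit.
Unset Printing Implicit Defensive.

Import Order.TTheory GRing.Theory Num.Theory.
Local Open Scope ring_scope.

Section LeastEnergy.
Context {R : realType} {E : finType}.
Implicit Types (rho eta x y z : {ffun E -> R}) (Gamma : set {ffun E -> R}).
Implicit Types (F : {set {set E}}) (mu : {set E} -> R).

(** * Euclidean geometry of densities and points of least norm *)

Lemma dotC x y : dot x y = dot y x.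
Proof. by apply: eq_bigr => e _; rewrite mulrC. Qed.

Lemma dotxx x : dot x x = energy2 x.
Proof. by apply: eq_bigr => e _; rewrite expr2. Qed.

Lemma dotZr x y z c : (forall e, z e = c * y e) -> dot x z = c * dot x y.
Proof.
by move=> zE; rewrite mulr_sumr; apply: eq_bigr => e _; rewrite zE mulrCA.
Qed.

Lemma energy2_ge0 x : 0 <= energy2 x.
Proof. by apply: sumr_ge0 => e _; apply: sqr_ge0. Qed.

Lemma energy2Z x y c : (forall e, x e = c * y e) ->
  energy2 x = c ^+ 2 * energy2 y.
Proof.
by move=> xE; rewrite mulr_sumr; apply: eq_bigr => e _; rewrite xE exprMn.
Qed.

Lemma energy2_lin x y z t : (forall e, z e = x e + t * y e) ->
  energy2 z = energy2 x + 2 * t * dot x y + t ^+ 2 * energy2 y.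
Proof.
move=> zE; rewrite /energy2 /dot !mulr_sumr -!big_split /=.
by apply: eq_bigr => e _; rewrite zE; ring.
Qed.

Lemma energy2_sub x y :
  energy2 [ffun e => x e - y e] = energy2 x - 2 * dot x y + energy2 y.
Proof.
rewrite (@energy2_lin x y _ (-1)); first by ring.
by move=> e; rewrite ffunE mulN1r.
Qed.

(** Expanding [|y - x|^2 >= 0] gives [|y|^2 >= 2<y, x> - |x|^2]. So [x] has least norm in the
    half-space [<y, x> >= |x|^2], which serves below as the test for minimality. *)
Lemma energy2_le_dot x y : energy2 x <= dot y x -> energy2 x <= energy2 y.
Proof.
by move=> xy; have := energy2_ge0 [ffun e => y e - x e]; rewrite energy2_sub; lra.
Qed.

(** Here the same expansion forces [|y - x|^2 <= 0]; this gives uniqueness of the minimizers. *)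
Lemma energy2_le_dot_eq x y :
  energy2 x <= dot y x -> energy2 y <= energy2 x -> y = x.
Proof.
move=> xy yx; set d := [ffun e => y e - x e].
have d0 : energy2 d = 0.
  by apply/eqP; rewrite eq_le energy2_ge0 andbT energy2_sub; lra.
have sq0 := psumr_eq0P (fun e _ => sqr_ge0 (d e)) d0.
apply/ffunP => e; apply/eqP; rewrite -subr_eq0 -(sqrf_eq0 (y e - x e)).
by have := sq0 e isT; rewrite ffunE => ->.
Qed.

(** First-order condition: the right side is [|x + t y|^2], and a negative linear term would beat
    the quadratic one for small [t]. The range of [t] is that of convex combinations. *)
Lemma dot_ge0_of_energy2_min x y :
  (forall t, 0 < t -> t <= 1 ->
     energy2 x <= energy2 x + 2 * t * dot x y + t ^+ 2 * energy2 y) ->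
  0 <= dot x y.
Proof.
move=> min_x; rewrite leNgt; apply/negP => xy_lt0.
have D_ge0 := energy2_ge0 y.
(* The step [t = a / s] satisfies [t <= 1] and [t |y|^2 <= a], so the increment [-2 t a + t^2 |y|^2]
   is at most [- t a < 0]. *)
set a := - dot x y; set s := a + energy2 y.
have a_gt0 : 0 < a by rewrite oppr_gt0.
have s_gt0 : 0 < s by rewrite /s; lra.
have t_gt0 : 0 < a / s by rewrite divr_gt0.
have t_le1 : a / s <= 1 by rewrite ler_pdivrMr // mul1r /s; lra.
have := min_x _ t_gt0 t_le1; apply/negP; rewrite -ltNge.
have tD : a / s * energy2 y <= a.
  by rewrite -mulrA [s^-1 * _]mulrC mulrA ler_pdivrMr // ler_pM2l // /s; lra.
have -> : dot x y = - a by rewrite opprK.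
by set t := a / s in t_gt0 tD *; nra.
Qed.

Lemma ereal_inf_attainedP (T : Type) (A : set T) (f : T -> R) a : A a ->
  (f a)%:E = ereal_inf [set (f b)%:E | b in A]%classic <->
  (forall b, A b -> f a <= f b).
Proof.
move=> Aa; split=> [inf_a b Ab | min_a].
  by rewrite -lee_fin inf_a; apply: ereal_inf_lbound; exists b.
apply/eqP; rewrite eq_le; apply/andP; split.
  by apply: le_ereal_inf_tmp => _ [b Ab <-]; rewrite lee_fin min_a.
by apply: ereal_inf_lbound; exists a.
Qed.

Lemma optimal_Mod2P Gamma rho : optimal_Mod2 Gamma rho <->
  Adm Gamma rho /\ forall rho', Adm Gamma rho' -> energy2 rho <= energy2 rho'.
Proof.
by split=> -[Arho min_rho]; split=> //; apply/(ereal_inf_attainedP _ Arho).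
Qed.

Lemma optimal_MEOP F mu : optimal_MEO F mu <->
  is_pmf F mu /\ forall mu', is_pmf F mu' -> overlap F mu <= overlap F mu'.
Proof.
by split=> -[pmu min_mu]; split=> //;
  apply/(@ereal_inf_attainedP _ (is_pmf F) (overlap F) _ pmu).
Qed.

(** * Usage vectors of mass functions *)

Definition usage F mu : {ffun E -> R} :=
  [ffun e => \sum_(B in F | e \in B) mu B].

Lemma usage_ge0 F mu : is_pmf F mu -> nonneg (usage F mu).
Proof.
by case=> mu_ge0 _ e; rewrite ffunE; apply: sumr_ge0 => B /andP[/mu_ge0].
Qed.

Lemma dot_indicator B rho : dot (indicator B) rho = length rho B.
Proof.
rewrite /dot /length [RHS]big_mkcond; apply: eq_bigr => e _.
by rewrite ffunE; case: (e \in B); rewrite ?mul1r ?mul0r.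
Qed.

Lemma dot_usage F mu rho :
  dot (usage F mu) rho = \sum_(B in F) mu B * length rho B.
Proof.
rewrite /dot; under eq_bigr => e _ do rewrite ffunE mulr_suml.
under [RHS]eq_bigr => B _ do rewrite /length mulr_sumr.
rewrite (exchange_big_dep (mem F)) /=; last by move=> e B _ /andP[].
by apply: eq_bigr => B BF; apply: eq_bigl => e; rewrite BF.
Qed.

Lemma length_usage F mu (B : {set E}) :
  length (usage F mu) B = \sum_(B' in F) mu B' * #|B :&: B'|%:R.
Proof.
rewrite -dot_indicator dotC dot_usage; apply: eq_bigr => B' _; congr (_ * _).
rewrite -sum1_card natr_sum /length [RHS]big_mkcond [LHS]big_mkcond.
apply: eq_bigr => e _; rewrite !inE ffunE.
by case: (e \in B); case: (e \in B').
Qed.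

Lemma overlap_usage F mu : overlap F mu = energy2 (usage F mu).
Proof.
rewrite -dotxx dot_usage; apply: eq_bigr => B _.
by rewrite length_usage mulr_sumr; apply: eq_bigr => B' _; rewrite mulrA.
Qed.

Lemma Adm_vectorsP F rho : Adm (vectors F) rho <->
  nonneg rho /\ forall B, B \in F -> 1 <= length rho B.
Proof.
split=> -[rho_ge0 rhoF]; split=> //.
  by move=> B BF; rewrite -dot_indicator; apply: rhoF; exists B.
by move=> _ [B BF <-]; rewrite dot_indicator rhoF.
Qed.

(** Pairing with [rho] averages lengths that are all at least 1. *)
Lemma usage_BL F mu : is_pmf F mu -> BL (Adm (vectors F)) (usage F mu).
Proof.
move=> pmu; split; first exact: usage_ge0.
case: (pmu) => mu_ge0 mu1 rho /Adm_vectorsP[_ rhoF].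
rewrite dot_usage -mu1; apply: ler_sum => B BF.
by rewrite ler_peMr ?mu_ge0 ?rhoF.
Qed.

Lemma is_pmf_shift F mu B t : is_pmf F mu -> B \in F -> 0 <= t <= 1 ->
  is_pmf F (fun B' => (1 - t) * mu B' + t * (B' == B)%:R).
Proof.
move=> [mu_ge0 mu1] BF /andP[t_ge0 t_le1]; split=> [B' B'F|].
  by rewrite addr_ge0 ?mulr_ge0 ?mu_ge0 ?subr_ge0 ?ler0n.
rewrite big_split /= -!mulr_sumr mu1 (bigD1 B) //= eqxx big1 => [|B' /andP[_]].
  by rewrite addr0 !mulr1 subrK.
by move/negPf->.
Qed.

Lemma usage_shift F mu B t e : B \in F ->
  usage F (fun B' => (1 - t) * mu B' + t * (B' == B)%:R) e =
  usage F mu e + t * (indicator B e - usage F mu e).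
Proof.
move=> BF; rewrite !ffunE big_split /= -!mulr_sumr.
suff -> : \sum_(B' in F | e \in B') (B' == B)%:R = (e \in B)%:R :> R by ring.
rewrite big_mkcondr (bigD1 B) //= eqxx big1 => [|B' /andP[_ /negPf->]].
  by rewrite addr0; case: (e \in B).
by case: ifP.
Qed.

(** Moving a fraction [t] of the mass to [B] moves the usage vector by [t d], so minimality along
    this segment gives [<eta, d> >= 0]. *)
Lemma optimal_MEO_length F mu B : optimal_MEO F mu -> B \in F ->
  energy2 (usage F mu) <= length (usage F mu) B.
Proof.
move=> /optimal_MEOP[pmu min_mu] BF; set eta := usage F mu.
pose d : {ffun E -> R} := [ffun e => indicator B e - eta e].
have <- : dot eta d + energy2 eta = length eta B.
  rewrite -dot_indicator -dotxx /dot -big_split /=.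
  by apply: eq_bigr => e _; rewrite [d e]ffunE; ring.
rewrite lerDr; apply: dot_ge0_of_energy2_min => t t_gt0 t_le1.
have t01 : 0 <= t <= 1 by rewrite t_le1 ltW.
have := min_mu _ (is_pmf_shift pmu BF t01).
rewrite !overlap_usage -/eta => /le_trans; apply.
by rewrite (@energy2_lin eta d _ t) // => e; rewrite usage_shift // [d e]ffunE.
Qed.

(** * Complementary slackness and optimality *)

Definition slack F mu rho := forall B, B \in F -> mu B * (1 - length rho B) = 0.

Lemma slack_dot F mu rho : is_pmf F mu -> slack F mu rho ->
  dot (usage F mu) rho = 1.
Proof.
move=> [_ <-] slk; rewrite dot_usage; apply: eq_bigr => B BF.
by apply/eqP; rewrite eq_sym -subr_eq0 -{1}[mu B]mulr1 -mulrBr slk.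
Qed.

(** The [mu]-average of the nonnegative excesses [length rho B - 1] vanishes, hence so does each of
    its terms. *)
Lemma dot_slack F mu rho : is_pmf F mu -> Adm (vectors F) rho ->
  dot (usage F mu) rho = 1 -> slack F mu rho.
Proof.
move=> [mu_ge0 mu1] /Adm_vectorsP[_ rhoF] dot1 B BF.
have sum0 : \sum_(B in F) mu B * (length rho B - 1) = 0.
  under eq_bigr => B' _ do rewrite mulrBr mulr1.
  by rewrite sumrB -dot_usage dot1 mu1 subrr.
have ge0 B' : B' \in F -> 0 <= mu B' * (length rho B' - 1).
  by move=> B'F; rewrite mulr_ge0 ?mu_ge0 // subr_ge0 rhoF.
by rewrite -opprB mulrN (psumr_eq0P ge0 sum0) // oppr0.
Qed.

(** Slackness makes the duality inequality [<rho', eta'> >= 1] tight at [rho] and [eta]. As these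
    are parallel, that inequality becomes the half-space condition of [energy2_le_dot] for both of
    them. *)
Lemma slack_optimal F mu rho Gamma c :
  Adm Gamma = BL (Adm (vectors F)) -> is_pmf F mu -> 0 < c ->
  Adm (vectors F) rho -> (forall e, rho e = c * usage F mu e) ->
  slack F mu rho ->
  [/\ optimal_Mod2 (vectors F) rho, optimal_Mod2 Gamma (usage F mu),
      optimal_MEO F mu, energy2 rho = c & energy2 (usage F mu) = c^-1].
Proof.
move=> dualF pmu c_gt0 Arho rhoE slk; set eta := usage F mu.
have ceta : c * energy2 eta = 1.
  by rewrite -dotxx -(dotZr eta rhoE) slack_dot.
have etaE : energy2 eta = c^-1 by rewrite -[RHS]mulr1 -ceta mulKf ?gt_eqF.
have rhoE2 : energy2 rho = c by rewrite (energy2Z rhoE) expr2 -mulrA ceta mulr1.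
have eta_min eta' : BL (Adm (vectors F)) eta' -> energy2 eta <= energy2 eta'.
  move=> [_ /(_ _ Arho)]; rewrite (dotZr _ rhoE) => ge1.
  by apply: energy2_le_dot; rewrite etaE -[c^-1]mul1r ler_pdivrMr // mulrC.
split=> //.
- apply/optimal_Mod2P; split=> // rho' Arho'; apply: energy2_le_dot.
  have [_ /(_ _ Arho') ge1] := usage_BL pmu.
  by rewrite rhoE2 (dotZr _ rhoE) dotC ler_peMr // ltW.
- by apply/optimal_Mod2P; rewrite dualF; split=> //; apply: usage_BL.
(* Every usage vector lies in the blocker, where [eta] already has least energy. *)
- apply/optimal_MEOP; split=> // mu' pmu'; rewrite !overlap_usage.
  by apply: eta_min; apply: usage_BL.
Qed.

(** The constant density 1 is admissible when all members of [F] are nonempty, and a zero usage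
    vector could not pair to at least 1 with it. *)
Lemma energy2_usage_gt0 F mu : finset.set0 \notin F -> is_pmf F mu ->
  0 < energy2 (usage F mu).
Proof.
move=> F0 pmu; pose one : {ffun E -> R} := [ffun=> 1].
have Aone : Adm (vectors F) one.
  apply/Adm_vectorsP; split=> [e|B BF]; first by rewrite ffunE.
  rewrite /length (eq_bigr (fun=> 1)) => [|e _]; last by rewrite ffunE.
  rewrite sumr_const ler1n card_gt0.
  by apply: contraNneq F0 => <-.
have [_ /(_ _ Aone) ge1] := usage_BL pmu.
rewrite lt_neqAle energy2_ge0 andbT; apply/eqP => /esym e0.
have sq0 := psumr_eq0P (fun e _ => sqr_ge0 (usage F mu e)) e0.
move: ge1; rewrite /dot big1 ?ler10 // => e _.
by have /eqP := sq0 e isT; rewrite sqrf_eq0 => /eqP ->; rewrite mul0r.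
Qed.

(** An optimal [mu] yields an explicit pair [rho0], [eta0]; uniqueness of the points of least norm
    identifies [rho] and [eta] with it. *)
Lemma optimal_slack F mu rho eta Gamma :
  Adm Gamma = BL (Adm (vectors F)) -> finset.set0 \notin F ->
  optimal_Mod2 (vectors F) rho -> optimal_Mod2 Gamma eta ->
  optimal_MEO F mu ->
  [/\ eta = usage F mu, exists c, 0 < c /\ forall e, rho e = c * eta e
    & slack F mu rho].
Proof.
move=> dualF F0 /optimal_Mod2P[Arho min_rho] /optimal_Mod2P[Aeta min_eta] opt_mu.
have pmu := opt_mu.1; set eta0 := usage F mu; set m := energy2 eta0.
have m_gt0 : 0 < m by apply: energy2_usage_gt0.
(* By [optimal_MEO_length] each member of [F] has [eta0]-length at least [m], so dividing by [m]
   gives an admissible density. *)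
pose rho0 : {ffun E -> R} := [ffun e => m^-1 * eta0 e].
have rho0E e : rho0 e = m^-1 * eta0 e by rewrite ffunE.
have Arho0 : Adm (vectors F) rho0.
  apply/Adm_vectorsP; split=> [e|B BF].
    by rewrite rho0E mulr_ge0 ?(usage_ge0 pmu) // invr_ge0 ltW.
  rewrite -dot_indicator (dotZr _ rho0E) dot_indicator mulrC ler_pdivlMr //.
  by rewrite mul1r optimal_MEO_length.
have dot0 : dot eta0 rho0 = 1.
  by rewrite (dotZr _ rho0E) dotxx mulVf ?gt_eqF.
have BLeta0 : BL (Adm (vectors F)) eta0 by apply: usage_BL.
have rho0E2 : energy2 rho0 = m^-1.
  by rewrite -dotxx (dotZr _ rho0E) dotC dot0 mulr1.
rewrite dualF in Aeta min_eta.
(* Testing [eta] against [rho0] gives [<eta, eta0> >= m = |eta0|^2], while [eta0] competes with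
   [eta] in the blocker. *)
have eta_eq : eta = eta0.
  apply: energy2_le_dot_eq; last exact: min_eta.
  have [_ /(_ _ Arho0)] := Aeta.
  by rewrite (dotZr _ rho0E) mulrC ler_pdivlMr // mul1r.
have rho_eq : rho = rho0.
  apply: energy2_le_dot_eq; last exact: min_rho.
  have [_ /(_ _ Arho) ge1] := BLeta0.
  by rewrite rho0E2 (dotZr _ rho0E) dotC ler_peMr // invr_ge0 ltW.
split=> //; last by rewrite rho_eq; apply: dot_slack.
by exists m^-1; rewrite invr_gt0 rho_eq eta_eq.
Qed.

End LeastEnergy.

(** If the empty set were a maximal independent set, an element [e] of any independent set would
    give the larger independent set [{e}]; so the rank would be 0. *)
Lemma set0_notin_bases (E : finType) (M : matroid E) : loopless M ->
  (0 < rank M [set: E]%SET)%N -> finset.set0 \notin bases M.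
Proof.
move=> ll; apply: contraL; rewrite inE => /maxsetP[_ max0].
rewrite -eqn0Ngt -leqn0; apply/bigmax_leqP => I _.
rewrite leqn0 cards_eq0; apply/set0Pn => -[e _].
have /setP/(_ e) := max0 _ (ll e) (finset.sub0set _).
by rewrite !inE eqxx.
Qed.

Theorem theorem3p2 (R : realType) (E : finType) (M : matroid E)
    (M_loopless : loopless M) (rank_gt0 : (0 < rank M [set: E]%SET)%N)
    (dualB : set {ffun E -> R})
    (dualB_Fulkerson : Fulkerson_dual (vectors (bases M)) dualB)
    (rho eta : {ffun E -> R}) (rho_ge0 : nonneg rho) (eta_ge0 : nonneg eta)
    (mu : {set E} -> R) (mu_pmf : is_pmf (bases M) mu) :
  let optimal :=
    [/\ optimal_Mod2 (vectors (bases M)) rho,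
        optimal_Mod2 dualB eta
      & optimal_MEO (bases M) mu] in
  (optimal <->
    [/\ Adm (vectors (bases M)) rho /\
          (forall e, eta e = \sum_(B in bases M | e \in B) mu B),
        exists c : R, 0 < c /\ (forall e, rho e = c * eta e)
      & forall B, B \in bases M -> mu B * (1 - length rho B) = 0]) /\
  (optimal -> forall c : R, 0 < c -> (forall e, rho e = c * eta e) ->
    [/\ c%:E = Mod2 (vectors (bases M)),
        (c^-1)%:E = MEO (R := R) (bases M)
      & (c^-1)%:E = Mod2 dualB]).
Proof.
move=> optimal; have [_ dualF] := dualB_Fulkerson.
have F0 := set0_notin_bases M_loopless rank_gt0.
split; [split|].
- move=> [opt_rho opt_eta opt_mu].
  have [eta_eq rho_eta slk] := optimal_slack dualF F0 opt_rho opt_eta opt_mu.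
  by split=> //; split=> [|e]; [case: opt_rho | rewrite eta_eq ffunE].
- move=> [[Arho etaE] [c [c_gt0 rhoE]] slk].
  have eta_eq : eta = usage (bases M) mu by apply/ffunP => e; rewrite ffunE.
  rewrite eta_eq in rhoE.
  have [] := slack_optimal dualF mu_pmf c_gt0 Arho rhoE slk.
  by rewrite /optimal eta_eq.
- move=> [opt_rho opt_eta opt_mu] c c_gt0 rhoE.
  have [eta_eq _ slk] := optimal_slack dualF F0 opt_rho opt_eta opt_mu.
  rewrite eta_eq in rhoE opt_eta.
  (* [slack_optimal] is applied to the given [c], so the values hold for any constant of
     proportionality, not just the witness found above. *)
  have [_ _ _ rho2 eta2] :=
    slack_optimal dualF mu_pmf c_gt0 opt_rho.1 rhoE slk.
  by rewrite -opt_rho.2 -opt_eta.2 -opt_mu.2 overlap_usage rho2 eta2.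
Qed.
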